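(* Let $r\ge3$ and $p=p(n)\gg n^{-2/(r+1)}$. With high probability as $n\to\infty$, every orientation of $G(n,p)$ contains a transitively oriented copy of $K_r$.
   Context: $G(n,p)$ is the Erdős–Rényi random graph on $n$ vertices with edge probability $p$. An orientation assigns a direction to each edge. $f\gg g$ means $g/f\to0$ as $n\to\infty$. *)

(* Defs.v *)
From HB Require Import structures.
From mathcomp Require Import all_boot all_order all_algebra.
From mathcomp Require Import all_classical all_reals all_analysis.
Set Implicit Arguments.
Unset Strict Implicit.
Unset Printing Implicit Defensive.
Import Order.TTheory GRing.Theory Num.Theory.
Import numFieldNormedType.Exports.
Local Open Scope ring_scope.

(* A simple graph on the vertex set 'I_n is represented by its edge set,
   a subset of [pairs n]. *)
Definition pairs (n : nat) : {set {set 'I_n}} := [set e : {set 'I_n} | #|e| == 2].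

Definition gnp_weight (R : realType) (n : nat) (q : R) (G : {set {set 'I_n}}) : R :=
  \prod_(e in pairs n) (if e \in G then q else 1 - q).

Definition gnp_prob (R : realType) (n : nat) (q : R)
    (A : pred {set {set 'I_n}}) : R :=
  \sum_(G : {set {set 'I_n}} | (G \subset pairs n) && A G) gnp_weight q G.

Lemma gnp_prob_total (R : realType) (n : nat) (q : R) :
  gnp_prob (n := n) q predT = 1.
Proof.
pose F (e : {set 'I_n}) : R := if e \in pairs n then q else 0.
pose F' (e : {set 'I_n}) : R := if e \in pairs n then 1 - q else 1.
have : \prod_e (F e + F' e) = 1.
  by apply: big1 => e _; rewrite /F /F'; case: ifP => _; rewrite ?add0r ?subrKC.
rewrite bigA_distr => <-; rewrite /gnp_prob.
rewrite [RHS](bigID (fun G : {set {set 'I_n}} => G \subset pairs n)) /=.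
rewrite [X in _ = _ + X]big1 ?addr0; last first.
  move=> G /fintype.subsetPn [e eG eP]; rewrite (bigD1 e) //= eG /F (negbTE eP).
  by rewrite mul0r.
apply: eq_big => [G|G /andP[GP _]]; first by rewrite andbT.
rewrite /gnp_weight big_mkcond /=; apply: eq_bigr => e _.
rewrite /F /F'; case: ifP => // /negbT eP.
by rewrite (negbTE (contra (fintype.subsetP GP e) eP)).
Qed.

(* [D] is the set of arcs: every arc lies on an edge of [G], and every edge
   {u, v} of [G] carries exactly one of the arcs (u, v) and (v, u). *)
Definition is_orientation (n : nat) (G : {set {set 'I_n}})
    (D : {set 'I_n * 'I_n}) : bool :=
  [forall u, forall v, ((u, v) \in D) ==> ([set u; v] \in G)] &&
  [forall u, forall v,
     ([set u; v] \in G) ==> (((u, v) \in D) (+) ((v, u) \in D))].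

Definition is_clique (n : nat) (G : {set {set 'I_n}}) (S : {set 'I_n}) : bool :=
  [forall x in S, forall y in S, (x != y) ==> ([set x; y] \in G)].

Definition transitive_on (n : nat) (D : {set 'I_n * 'I_n}) (S : {set 'I_n}) : bool :=
  [forall x in S, forall y in S, forall z in S,
     ((x, y) \in D) ==> ((y, z) \in D) ==> ((x, z) \in D)].

Definition has_transitive_clique (n : nat) (r : nat) (G : {set {set 'I_n}})
    (D : {set 'I_n * 'I_n}) : bool :=
  [exists S : {set 'I_n}, [&& #|S| == r, is_clique G S & transitive_on D S]].

Definition every_orientation_has_transitive_clique (n r : nat)
    (G : {set {set 'I_n}}) : bool :=
  [forall D : {set 'I_n * 'I_n},
     is_orientation G D ==> has_transitive_clique r G D].

(* f >> g, i.e. g / f -> 0. Since x / 0 = 0, the quotient is required to be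
   eventually well defined. *)
Definition much_larger (R : realType) (f g : nat -> R) : Prop :=
  ((\forall n \near \oo, f n != 0) /\ (g n / f n @[n --> \oo] --> (0 : R)))%classic.

Definition with_high_probability (R : realType) (p : nat -> R)
    (A : forall n : nat, pred {set {set 'I_n}}) : Prop :=
  (gnp_prob (p n) (A n) @[n --> \oo] --> (1 : R))%classic.

(* Main.v *)
(** Hypergraph containers and a union bound over fingerprints. The vertices of
    the hypergraph are the arcs on ['I_n], its edges the arc sets of transitive
    r-tournaments, so an orientation without a transitive K_r is an independent
    set. A set L of arcs spanning v <= r points has at most 'C(v, 2) elements and
    lies in O(n^(r-v)) hyperedges, so the normalized codegree of L is
    O(q^(|L| - 1)) for q = n^(-2/(r+1)). Hence every such orientation D contains
    a fingerprint F of O(q n^2) arcs that determines a container C of D spanning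
    few transitive r-tournaments. Since a tournament on 2^r vertices contains a
    transitive r-tournament, averaging shows that C misses both arcs of at least
    d n^2 pairs, and none of these pairs is an edge of G. For a given F this has
    probability at most p^|F| (1 - p)^(d n^2); as |F| = o(p n^2), the sum over F
    tends to 0. *)
Require Import Defs.
From mathcomp Require Import all_boot all_order all_algebra.
From mathcomp Require Import all_classical all_reals all_analysis.
From mathcomp Require Import fintype finset zify lra ring.
Set Implicit Arguments.
Unset Strict Implicit.
Unset Printing Implicit Defensive.
Import Order.TTheory GRing.Theory Num.Theory.
Import numFieldNormedType.Exports.
Local Open Scope ring_scope.

(** * Families with containers *)

(* Every I in Fam has a fingerprint F of size at most b, and Cf computes a good
   container of I from F. Letting Cf read any F' between F and I makes
   containers compose under queries v \in I: the query is answered by v \in F'. *)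
Definition containable (R : realFieldType) (V : finType) (good : pred {set V})
    (Fam : {set V} -> Prop) (b : R) : Prop :=
  exists Cf : {set V} -> {set V}, forall I, Fam I ->
    exists F : {set V}, [/\ F \subset I, #|F|%:R <= b &
      forall F' : {set V}, F \subset F' -> F' \subset I ->
        I \subset Cf F' /\ good (Cf F')].

Lemma containable_leaf (R : realFieldType) (V : finType) (good : pred {set V})
    (Fam : {set V} -> Prop) (b : R) (C : {set V}) :
  0 <= b -> good C -> (forall I, Fam I -> I \subset C) -> containable good Fam b.
Proof.
move=> b0 gC FC; exists (fun=> C) => I FI; exists set0.
by rewrite sub0set cards0; split=> // F' _ _; split=> //; apply: FC.
Qed.

Lemma containable_sub (R : realFieldType) (V : finType) (good : pred {set V})
    (Fam Fam' : {set V} -> Prop) (b b' : R) :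
  b <= b' -> (forall I, Fam' I -> Fam I) ->
  containable good Fam b -> containable good Fam' b'.
Proof.
move=> bb' FF' [Cf CfP]; exists Cf => I /FF' /CfP [F [FI Fb FP]].
by exists F; split=> //; apply: le_trans bb'.
Qed.

(** Only a positive answer puts [v] into the fingerprint, hence the budget [b - 1] on that
    branch. *)
Lemma containable_query (R : realFieldType) (V : finType) (good : pred {set V})
    (Fam : {set V} -> Prop) (b : R) (v : V) :
  containable good (fun I => Fam I /\ v \notin I) b ->
  containable good (fun I => Fam I /\ v \in I) (b - 1) ->
  containable good Fam b.
Proof.
move=> [Cn CnP] [Cy CyP].
exists (fun F : {set V} => if v \in F then Cy F else Cn F) => I FI.
have [vI|vI] := boolP (v \in I).
  have [F [sFI Fb FP]] := CyP I (conj FI vI).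
  exists (v |: F); split.
  - by rewrite subUset sub1set vI.
  - rewrite cardsU1 natrD; have : (v \notin F)%:R <= 1 :> R by case: (v \notin F).
    by lra.
  - move=> F' /[!subUset] /andP[/[!sub1set] -> sFF'] F'I; exact: FP.
have [F [sFI Fb FP]] := CnP I (conj FI vI).
exists F; split=> // F' sFF' F'I; rewrite ifN; first exact: FP.
by apply: contra vI => /(subsetP F'I).
Qed.

(** * Weighted hypergraphs, codegrees and links *)

Definition wdeg (R : realFieldType) (V : finType) (w : {set V} -> R)
  (L : {set V}) : R := \sum_(E : {set V} | L \subset E) w E.

Definition wtotal (R : realFieldType) (V : finType) (w : {set V} -> R) : R :=
  \sum_(E : {set V}) w E.

Lemma wdeg0 (R : realFieldType) (V : finType) (w : {set V} -> R) :
  wdeg w set0 = wtotal w.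
Proof. by apply: eq_bigl => E; rewrite sub0set. Qed.

(** Sets containing [v] get weight 0; otherwise an edge through [v] would count twice, with and
    without [v]. *)
Definition link (R : realFieldType) (V : finType) (a : {set V} -> R) (v : V)
  (E : {set V}) : R := if v \notin E then a (v |: E) else 0.

Lemma wdeg_link (R : realFieldType) (V : finType) (a : {set V} -> R) v L :
  wdeg (link a v) L = if v \in L then 0 else wdeg a (v |: L).
Proof.
rewrite /wdeg /link -big_mkcondr /=; case: ifPn => vL.
  rewrite big_pred0 // => E; apply/negP => /andP[LE].
  by rewrite (subsetP LE).
rewrite [RHS](reindex_onto (fun E => v |: E) (fun E => E :\ v)) /=; last first.
  by move=> E /[!subUset] /andP[/[!sub1set] vE _]; rewrite setD1K.
apply: eq_bigl => E; rewrite subUset sub1set setU11 /=.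
have [vE|vE] := boolP (v \in E).
  by rewrite andbF; apply/esym/negP => /andP[_ /eqP EE]; rewrite -EE setD11 in vE.
rewrite setU1K // eqxx !andbT; apply/idP/idP => [LE|LE].
  exact: subset_trans (subsetU1 _ _).
by rewrite -(setU1K vE) subsetD1 LE.
Qed.

Lemma sum_wdeg1 (R : realFieldType) (V : finType) (w : {set V} -> R) :
  \sum_v wdeg w [set v] = \sum_E w E *+ #|E|.
Proof.
rewrite /wdeg.
rewrite (exchange_big_dep predT) //=; apply: eq_bigr => E _.
rewrite (eq_bigl (fun v => v \in E)) ?sumr_const // => v.
by rewrite sub1set.
Qed.

Lemma sum_wdeg (R : realFieldType) (V : finType) (w : {set V} -> R) :
  \sum_L wdeg w L = \sum_E w E *+ 2 ^ #|E|.
Proof.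
rewrite /wdeg (exchange_big_dep predT) //=; apply: eq_bigr => E _.
rewrite (eq_bigl (fun L => L \in powerset E)) ?sumr_const ?card_powerset // => L.
by rewrite powersetE.
Qed.

(** * One run of the container algorithm *)

(* w is the current hypergraph and w' the hypergraph, of uniformity one less,
   accumulated from links of vertices of I. Edges of w through saturated sets
   are discarded to keep the codegrees of w' below 2 K q ^ (|L| - 1). *)
Definition saturated (R : realFieldType) (V : finType) (K q : R)
    (w' : {set V} -> R) (L : {set V}) : bool :=
  (L != set0) && (K * q ^+ #|L|.-1 <= wdeg w' L).

Definition active (R : realFieldType) (V : finType) (K q : R)
    (w w' : {set V} -> R) (U E : {set V}) : R :=
  if [disjoint E & U] && [forall L : {set V}, (L \subset E) ==> ~~ saturated K q w' L]
  then w E else 0.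

(** An edge dropped from [active] meets [U] or contains a saturated set, so one of the two sums
    counts its weight. *)
Lemma active_weight (R : realFieldType) (V : finType) (K q : R)
    (w w' : {set V} -> R) (U : {set V}) :
  (forall E, 0 <= w E) ->
  wtotal w <= wtotal (active K q w w' U) + \sum_(v in U) wdeg w [set v]
                + \sum_(L | saturated K q w' L) wdeg w L.
Proof.
move=> w0; rewrite /wdeg.
rewrite (exchange_big_dep predT) //= [X in _ + X](exchange_big_dep predT) //=.
rewrite /wtotal -!big_split /=; apply: ler_sum => E _.
have nn (T : finType) (P : pred T) : 0 <= \sum_(i | P i) w E by apply: sumr_ge0.
rewrite /active; case: ifPn => [_|]; first by rewrite -addrA lerDl addr_ge0.
rewrite add0r negb_and => /orP[/pred0Pn[v /andP[/= vE vU]]|].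
  apply: ler_wpDr => //; rewrite (bigD1 v) /= ?vU ?sub1set //.
  by rewrite lerDl.
case/forallPn => L; rewrite negb_imply negbK => /andP[LE sL].
by apply: ler_wpDl => //; rewrite (bigD1 L) /= ?sL // lerDl.
Qed.

(** On a saturated [L], [wdeg w L <= K * q ^+ #|L|.-1 <= wdeg w' L]; the sum of [wdeg w' L] over all
    [L] counts each edge of [w'] once per subset. *)
Lemma saturated_weight (R : realFieldType) (V : finType) (K q : R) (k : nat)
    (w w' : {set V} -> R) :
  (forall E, 0 <= w' E) -> (forall E, w' E != 0 -> #|E| = k) ->
  (forall L, L != set0 -> wdeg w L <= K * q ^+ #|L|.-1) ->
  \sum_(L | saturated K q w' L) wdeg w L <= 2 ^+ k * wtotal w'.
Proof.
move=> w0 wk dw.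
have -> : 2 ^+ k * wtotal w' = \sum_L wdeg w' L.
  rewrite sum_wdeg /wtotal mulr_sumr; apply: eq_bigr => E _.
  have [->|/wk->] := eqVneq (w' E) 0; first by rewrite mulr0 mul0rn.
  by rewrite -[RHS]mulr_natl natrX.
rewrite [leRHS](bigID (saturated K q w')) /=; apply: ler_wpDr.
  by apply: sumr_ge0 => L _; apply: sumr_ge0.
apply: ler_sum => L /andP[L0]; apply: le_trans; exact: dw.
Qed.

Lemma exists_heavy_vertex (R : realFieldType) (V : finType) (k : nat)
    (a : {set V} -> R) (d : R) :
  (0 < #|V|)%N -> (forall E, 0 <= a E) -> (forall E, a E != 0 -> #|E| = k.+1) ->
  d * #|V|%:R <= wtotal a -> exists v, d <= wdeg a [set v].
Proof.
move=> V0 a0 ak da; apply/existsP; apply: contraTT da => /existsPn dv.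
rewrite -ltNge; apply: (@le_lt_trans _ _ (\sum_v wdeg a [set v])).
  rewrite sum_wdeg1; apply: ler_sum => E _.
  have [->|/ak->] := eqVneq (a E) 0; first by rewrite mul0rn.
  by rewrite mulrS lerDl mulrn_wge0.
have /card_gt0P[v0 _] := V0.
rewrite -sumr_const mulr_sumr.
have lt v : wdeg a [set v] < d * 1 by rewrite mulr1 ltNge; apply: dv.
rewrite (bigD1 v0) //= [ltRHS](bigD1 v0) //=; apply: ltr_leD => //.
by apply: ler_sum => v _; apply: ltW.
Qed.

(** No active edge contains a saturated [L], so nothing is added to its codegree. For unsaturated
    [L] the old codegree is below [K * q ^+ #|L|.-1], and the increment is at most
    [q^-1 * (K * q ^+ #|L|)], the same amount; hence the constant [2 * K]. *)
Lemma wdeg_add_link (R : realFieldType) (V : finType) (K q : R)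
    (w w' : {set V} -> R) (U : {set V}) (v : V) (L : {set V}) :
  0 < q -> 0 <= K ->
  (forall E, 0 <= w E) ->
  (forall L : {set V}, L != set0 -> wdeg w L <= K * q ^+ #|L|.-1) ->
  (forall L : {set V}, L != set0 -> wdeg w' L <= 2 * K * q ^+ #|L|.-1) ->
  L != set0 ->
  wdeg (fun E => w' E + q^-1 * link (active K q w w' U) v E) L
    <= 2 * K * q ^+ #|L|.-1.
Proof.
move=> q0 K0 w0 dw dw' L0.
rewrite {1}/wdeg big_split /= -mulr_sumr -/(wdeg w' L) -/(wdeg (link _ v) L).
rewrite wdeg_link; case: ifPn => vL; first by rewrite mulr0 addr0 dw'.
have [sL|nsL] := boolP (saturated K q w' L).
  rewrite [wdeg (active _ _ _ _ _) _]big1 ?mulr0 ?addr0 ?dw' // => E.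
  rewrite subUset => /andP[_ LE]; rewrite /active ifN // negb_and.
  by apply/orP; right; apply/forallPn; exists L; rewrite LE sL.
have : q^-1 * wdeg (active K q w w' U) (v |: L) <= K * q ^+ #|L|.-1.
  rewrite mulrC ler_pdivrMr //; apply: (@le_trans _ _ (wdeg w (v |: L))).
    by apply: ler_sum => E _; rewrite /active; case: ifP.
  have vL0 : v |: L != set0 by apply/set0Pn; exists v; rewrite setU11.
  apply: le_trans (dw _ vL0) _; rewrite cardsU1 vL /=.
  by rewrite -mulrA -exprSr prednK ?card_gt0.
move: nsL; rewrite /saturated L0 /= -ltNge => /ltW; lra.
Qed.

Lemma sum_add_link (R : realFieldType) (V : finType) (q : R)
    (w' a : {set V} -> R) (v : V) :
  wtotal (fun E => w' E + q^-1 * link a v E) = wtotal w' + q^-1 * wdeg a [set v].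
Proof.
rewrite /wtotal big_split /= -mulr_sumr -/(wtotal w') -/(wtotal (link a v)).
by rewrite -(wdeg0 (link a v)) wdeg_link inE setU0.
Qed.

Lemma active_neq0 (R : realFieldType) (V : finType) (K q : R)
    (w w' : {set V} -> R) (U E : {set V}) :
  active K q w w' U E != 0 -> w E != 0 /\ [disjoint E & U].
Proof. by rewrite /active; case: ifP => [/andP[-> _]//|_]; rewrite eqxx. Qed.

Lemma active_ge0 (R : realFieldType) (V : finType) (K q : R)
    (w w' : {set V} -> R) (U E : {set V}) :
  (forall E, 0 <= w E) -> 0 <= active K q w w' U E.
Proof. by move=> w0; rewrite /active; case: ifP. Qed.

(* The loop of the container algorithm: U is the set of queried vertices, X the
   set of those answered negatively. A positive answer on v adds the link of v,
   rescaled by 1 / q, to w'. The loop ends when X is large (then the container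
   shrinks) or when w' is heavy (then recurse on the uniformity). *)
Lemma container_descent (R : realFieldType) (k : nat) (K c c1 c2 q b : R)
    (V : finType) (good : pred {set V}) (C : {set V}) (w : {set V} -> R)
    (Fam : {set V} -> Prop) :
  0 < K -> 0 < c -> 0 < c1 -> 0 < c2 -> 0 < q -> (0 < #|V|)%N ->
  2 ^+ k * c2 <= c / 4 -> K * (c1 + 4 * q / c * c2) <= c / 4 ->
  (forall E, 0 <= w E) ->
  (forall E : {set V}, w E != 0 -> #|E| = k.+1 /\ E \subset C) ->
  (forall L : {set V}, L != set0 -> wdeg w L <= K * q ^+ #|L|.-1) ->
  c * #|V|%:R <= wtotal w ->
  (forall I, Fam I -> forall E : {set V}, E \subset I -> w E = 0) ->
  (forall X : {set V}, X \subset C -> c1 * #|V|%:R <= #|X|%:R ->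
    containable good (fun I => Fam I /\ [disjoint I & X]) b) ->
  (forall (w' : {set V} -> R) (Fam' : {set V} -> Prop), (forall E, 0 <= w' E) ->
    (forall E : {set V}, w' E != 0 -> #|E| = k /\ E \subset C) ->
    (forall L : {set V}, L != set0 -> wdeg w' L <= 2 * K * q ^+ #|L|.-1) ->
    c2 * #|V|%:R <= wtotal w' ->
    (forall I, Fam' I -> Fam I /\ forall E : {set V}, E \subset I -> w' E = 0) ->
    containable good Fam' b) ->
  forall m (U X : {set V}) (w' : {set V} -> R) (Fam' : {set V} -> Prop),
    (#|~: U| <= m)%N ->
    X \subset C -> X \subset U ->
    #|U|%:R <= #|X|%:R + 4 * q / c * wtotal w' ->
    (forall E, 0 <= w' E) ->
    (forall E : {set V}, w' E != 0 -> #|E| = k /\ E \subset C) ->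
    (forall L : {set V}, L != set0 -> wdeg w' L <= 2 * K * q ^+ #|L|.-1) ->
    wtotal w' < c2 * #|V|%:R ->
    (forall I, Fam' I -> [/\ Fam I, [disjoint I & X] &
                             forall E : {set V}, E \subset I -> w' E = 0]) ->
    containable good Fam'
      (b + 1 + 4 * q / c * (c2 * #|V|%:R - wtotal w')).
Proof.
move=> K0 c0 c10 c20 q0 V0 Hc2 Hc1 w0 wk dw wN Find Hstop Hrec.
have r0 : 0 < 4 * q / c by rewrite divr_gt0 // mulr_gt0.
elim/ltn_ind=> m IHm U X w' Fam' Um XC XU UX w'0 w'k dw' w'N FF'.
have d0 : 0 <= 4 * q / c * (c2 * #|V|%:R - wtotal w').
  by rewrite mulr_ge0 ?(ltW r0) // subr_ge0 ltW.
have [Xbig|Xsmall] := leP (c1 * #|V|%:R) #|X|%:R.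
  by apply: containable_sub (Hstop X XC Xbig) => [|I /FF'[? ? _] //]; lra.
(* Edges meeting [U] and edges through saturated sets each cost at most a quarter of [c * #|V|], by
   the smallness of [c1], [q] and [c2]. *)
have aN : c / 4 * #|V|%:R <= wtotal (active K q w w' U).
  have split4 (W A S T x : R) : 0 <= x -> x <= W -> W <= A + S + T -> S <= x / 4 ->
      T <= x / 4 -> x / 4 <= A by move=> *; lra.
  rewrite mulrAC; apply: (split4 _ _ _ _ _ _ wN (active_weight K q w' U w0)).
    by rewrite mulr_ge0 // ltW.
    apply: (@le_trans _ _ (K * #|U|%:R)).
      rewrite mulr_natr -sumr_const; apply: ler_sum => v _.
      by apply: le_trans (dw _ _) _; rewrite ?cards1 ?mulr1 // -cards_eq0 cards1.
    rewrite mulrAC; apply: (@le_trans _ _ (K * (c1 + 4 * q / c * c2) * #|V|%:R)).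
      rewrite -mulrA ler_pM2l // mulrDl -[4 * q / c * c2 * _]mulrA.
      apply: le_trans UX _; apply: lerD; first exact: ltW.
      by rewrite ler_pM2l // ltW.
    by rewrite ler_pM2r // ltr0n.
  apply: le_trans (saturated_weight w'0 (fun E h => proj1 (w'k E h)) dw) _.
  rewrite mulrAC; apply: (@le_trans _ _ (2 ^+ k * c2 * #|V|%:R)).
    by rewrite -mulrA ler_pM2l ?exprn_gt0 // ltW.
  by rewrite ler_pM2r // ltr0n.
have [v dv] : exists v, c / 4 <= wdeg (active K q w w' U) [set v].
  apply: (exists_heavy_vertex V0 _ _ aN) => [E|E]; first exact: active_ge0.
  by case/active_neq0 => /wk[->].
(* An active edge through [v] shows that [v] lies in [C] and was not queried before, so the
   induction measure drops. *)
have [E vE aE] : exists2 E : {set V}, v \in E & active K q w w' U E != 0.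
  apply/exists_inP; apply: contraTT dv => /exists_inPn nE.
  rewrite /wdeg big1 -?ltNge ?divr_gt0 // => E.
  by rewrite sub1set => /nE /negPn/eqP.
have [/wk[_ EC] EU] := active_neq0 aE.
have vC : v \in C by exact: (subsetP EC).
have vU : v \notin U by rewrite (disjointFr EU vE).
have UmS : (#|~: (v |: U)| < m)%N.
  apply: leq_trans Um; apply: proper_card; rewrite properC.
  by apply/properP; split; [exact: subsetUr | exists v; rewrite ?setU11].
apply: (@containable_query _ _ _ _ _ v).
  (* Negative answer: [U] and [X] both gain [v], and [w'] stays. *)
  apply: (IHm _ UmS _ (v |: X)) => //.
  - by rewrite subUset sub1set vC.
  - exact: setUS.
  - rewrite !cardsU1 vU (contra (subsetP XU v) vU) !natrD; move: UX; clear; lra.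
  - move=> I [/FF'[FI IX w'I] vI]; split=> //.
    rewrite disjoint_sym disjoints_subset subUset sub1set inE vI.
    by rewrite -disjoints_subset disjoint_sym.
pose w'' E := w' E + q^-1 * link (active K q w w' U) v E.
have link_neq0 F : link (active K q w w' U) v F != 0 -> v \notin F /\ w (v |: F) != 0.
  by rewrite /link; case: ifP => [vF /active_neq0[]|]; rewrite ?eqxx.
have link_ge0 F : 0 <= q^-1 * link (active K q w w' U) v F.
  rewrite mulr_ge0 ?invr_ge0 ?(ltW q0) // /link.
  by case: ifP => // _; apply: active_ge0.
have w''0 F : 0 <= w'' F by rewrite addr_ge0.
have w''k (F : {set V}) : w'' F != 0 -> #|F| = k /\ F \subset C.
  have [w'F|/w'k //] := eqVneq (w' F) 0.
  rewrite /w'' w'F add0r mulf_eq0 negb_or => /andP[_ /link_neq0[vF /wk[]]].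
  by rewrite cardsU1 vF add1n subUset => -[->] /andP[].
have dw'' (L : {set V}) : L != set0 -> wdeg w'' L <= 2 * K * q ^+ #|L|.-1.
  by apply: wdeg_add_link => //; apply: ltW.
(* A link edge inside [I] would, together with [v], be an edge of [w] inside [I]. *)
have w''I I : Fam' I /\ v \in I -> forall F : {set V}, F \subset I -> w'' F = 0.
  move=> [/FF'[FI _ w'I] vI] F sFI; rewrite /w'' w'I // add0r.
  apply/eqP; rewrite mulf_eq0; apply/orP; right; apply: contraT => /link_neq0[_].
  by rewrite (Find _ FI) ?eqxx // subUset sub1set vI.
(* A positive answer raises [4 * q / c * wtotal w'] by at least 1. This pays both for [v] in the
   bound on [#|U|] and for [v] in the fingerprint. *)
have gain : 1 <= 4 * q / c * (q^-1 * wdeg (active K q w w' U) [set v]).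
  rewrite [leRHS](_ : _ = wdeg (active K q w w' U) [set v] / (c / 4)).
    by rewrite ler_pdivlMr ?mul1r // divr_gt0.
  by field; rewrite !gt_eqF.
have sw'' := sum_add_link q w' (active K q w w' U) v.
(* On the last positive answer the total may overshoot [c2 * #|V|]; the [+ 1] in the budget pays for
   that vertex. *)
have [big|small] := leP (c2 * #|V|%:R) (wtotal w'').
  apply: containable_sub (Hrec w'' _ w''0 w''k dw'' big _) => [|I H|I H]; last 2 first.
  - exact: H.
  - by split; [case: H => /FF'[] | exact: w''I].
  - by move: d0; clear; lra.
apply: containable_sub (IHm _ UmS (v |: U) X w'' (fun I => Fam' I /\ v \in I)
  _ _ _ _ _ _ _ _ _) => //.
- rewrite /w'' sw''; move: gain; clear.
  by move: (q^-1 * _) (4 * q / c) (wtotal w') => x y z h; rewrite !(mulrBr, mulrDr); lra.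
- exact: subset_trans XU (subsetUr _ _).
- rewrite cardsU1 vU add1n -natr1 /w'' sw''; move: UX gain; clear.
  by move: (q^-1 * _) (4 * q / c) (wtotal w') => x y z ? ?; rewrite mulrDr; lra.
- move=> I H; split; [by case: H => /FF'[] | by case: H => /FF'[] | exact: w''I].
Qed.

(** * The container theorem *)

(** Induction on [k], for all [K] and [c]: the descent, started from [w' = 0], either leaves a large
    [X] to the caller or produces a hypergraph of uniformity one less, with constants [2 * K] and
    [c2]. *)
Lemma container_step (R : realFieldType) (k : nat) (K c : R) : 0 < K -> 0 < c ->
  exists c1 B q0 : R, [/\ 0 < c1, 0 < B, 0 < q0 &
  forall (V : finType) (good : pred {set V}) (C : {set V}) (w : {set V} -> R)
    (q b : R) (Fam : {set V} -> Prop),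
  0 < q -> q <= q0 -> 1 <= q * #|V|%:R ->
  (forall E, 0 <= w E) ->
  (forall E : {set V}, w E != 0 -> #|E| = k /\ E \subset C) ->
  (forall L : {set V}, L != set0 -> wdeg w L <= K * q ^+ #|L|.-1) ->
  c * #|V|%:R <= wtotal w ->
  (forall I, Fam I -> forall E : {set V}, E \subset I -> w E = 0) ->
  (forall X : {set V}, X \subset C -> c1 * #|V|%:R <= #|X|%:R ->
    containable good (fun I => Fam I /\ [disjoint I & X]) b) ->
  containable good Fam (b + B * (q * #|V|%:R))].
Proof.
elim: k K c => [|k IHk] K c K0 c0.
  (* Fam is empty: set0 is an edge and a subset of every I. *)
  exists 1, 1, 1; split=> // V good C w q b Fam q0 _ qN w0 wk _ wN Find _.
  have w00 : w set0 != 0.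
    have Npos : 0 < c * #|V|%:R :> R.
      by rewrite mulr_gt0 // -(pmulr_rgt0 _ q0) (lt_le_trans ltr01 qN).
    apply: contraTneq (lt_le_trans Npos wN) => w00; rewrite /wtotal big1 ?ltxx //.
    move=> E _; apply/eqP; apply: contraT => wE.
    by have [/eqP] := wk _ wE; rewrite cards_eq0 => /eqP E0; rewrite E0 w00 eqxx in wE.
  exists (fun=> set0) => I /Find /(_ set0 (sub0set _)) /eqP.
  by rewrite (negbTE w00).
(* This makes [2 ^+ k * c2] equal to [c / 4]. *)
pose c2 := c / 2 ^+ k.+2.
have c20 : 0 < c2 by rewrite divr_gt0 // exprn_gt0.
have K20 : 0 < 2 * K by rewrite mulr_gt0.
have [c1' [B [q0 [c1'0 B0 q00 IH]]]] := IHk _ _ K20 c20.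
pose c1 := Num.min c1' (c / (8 * K)).
have c10 : 0 < c1 by rewrite /c1 lt_min c1'0 divr_gt0 // mulr_gt0.
(* The bounds on [c1] and [q] make both terms of [K * (c1 + 4 * q / c * c2)] at most [c / 8]. In the
   budget, [B] serves the recursion and the rest the descent, whose [+ 1] is absorbed by
   [1 <= q * #|V|]. *)
exists c1, (B + 2 + 4 / c * c2), (Num.min q0 (c / (8 * K * (4 / c * c2)))).
have B'0 : 0 < 4 / c * c2 by rewrite mulr_gt0 // divr_gt0.
split=> //.
- by rewrite !addr_gt0.
- by rewrite lt_min q00 divr_gt0 // mulr_gt0 // mulr_gt0.
move=> V good C w q b Fam qpos; rewrite le_min => /andP[qq0 qq1] qN w0 wk dw wN Find Hstop.
have N0 : 0 < #|V|%:R :> R by rewrite -(pmulr_rgt0 _ qpos) (lt_le_trans ltr01 qN).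
have V0 : (0 < #|V|)%N by rewrite -(ltr0n R).
have b1 : b <= b + B * (q * #|V|%:R).
  by rewrite lerDl mulr_ge0 ?(ltW B0) // (le_trans ler01 qN).
pose z := fun _ : {set V} => 0 : R.
have t0 : wtotal z = 0 by rewrite /wtotal big1.
have D : containable good Fam
    (b + B * (q * #|V|%:R) + 1 + 4 * q / c * (c2 * #|V|%:R - wtotal z)).
  apply: (@container_descent _ k K c c1 c2 q (b + B * (q * #|V|%:R)) V good C w Fam
    K0 c0 c10 c20 qpos V0 _ _ w0 wk dw wN Find _ _ #|~: (set0 : {set V})| set0 set0 z Fam) => //.
  - rewrite /c2 !exprS; have e0 : 2 ^+ k != 0 :> R by rewrite expf_neq0.
    by rewrite [leLHS](_ : _ = c / 4) //; field.
  - have : K * c1 <= c / 8.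
      rewrite mulrC -ler_pdivlMr // -mulrA -invfM; by rewrite /c1 ge_min lexx orbT.
    have : K * (q * (4 / c * c2)) <= c / 8.
      move: qq1; rewrite ler_pdivlMr; last by rewrite !mulr_gt0 ?invr_gt0.
      clear; move: (4 / c * c2) => y h; rewrite ler_pdivlMr //.
      by have -> : K * (q * y) * 8 = q * (8 * K * y) by ring.
    by rewrite (_ : 4 * q / c * c2 = q * (4 / c * c2)) 1?mulrDr; [lra|ring].
  - by move=> X XC Xc1; apply: containable_sub b1 _ (Hstop X XC Xc1).
  - move=> w' Fam' w'0 w'k dw' w'N FF'; apply: (IH V good C w' q b Fam') => //.
    + by move=> I /FF'[].
    + move=> X XC Xc1; have Xc1' : c1 * #|V|%:R <= #|X|%:R.
        by apply: le_trans Xc1; rewrite ler_pM2r // /c1 ge_min lexx.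
      by apply: containable_sub (Hstop X XC Xc1') => // I [/FF'[]].
  - exact: sub0set.
  - by rewrite t0 cards0 mulr0 addr0.
  - by move=> E; rewrite /z eqxx.
  - by move=> L _; rewrite /wdeg big1 // mulr_ge0 ?exprn_ge0 ?ltW.
  - by rewrite t0 mulr_gt0.
  - by move=> I FI; split=> //; rewrite disjoint_sym disjoints_subset sub0set.
apply: containable_sub D => //; rewrite t0 subr0.
have : 4 * q / c * (c2 * #|V|%:R) = 4 / c * c2 * (q * #|V|%:R) by ring.
move: qN; clear; move: (q * _) (4 / c * c2) => x y; rewrite !mulrDl; lra.
Qed.

(** A container that is still too heavy admits another [container_step]. Each round yields good
    containers or removes at least [c1 * #|V|] vertices, so about [1 / c1] rounds suffice and their
    budgets add up. *)
Lemma container_theorem (R : realType) (k : nat) (K eps : R) :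
  0 < K -> 0 < eps ->
  exists B q0 : R, [/\ 0 < B, 0 < q0 &
  forall (V : finType) (w : {set V} -> R) (q : R),
  0 < q -> q <= q0 -> 1 <= q * #|V|%:R ->
  (forall E, 0 <= w E) ->
  (forall E : {set V}, w E != 0 -> #|E| = k) ->
  (forall L : {set V}, L != set0 -> wdeg w L <= K * q ^+ #|L|.-1) ->
  containable
    (fun C : {set V} => \sum_(E : {set V} | E \subset C) w E < eps * #|V|%:R)
    (fun I => forall E : {set V}, E \subset I -> w E = 0) (B * (q * #|V|%:R))].
Proof.
move=> K0 eps0.
have [c1 [B [q0 [c10 B0 q00 step]]]] := container_step k K0 eps0.
pose m := Num.bound c1^-1.
exists (m.+1%:R * B), q0; split=> //; first by rewrite mulr_gt0.
move=> V w q qpos qq0 qN w0 wk dw.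
set good := fun C : {set V} => _; set Fam := fun I : {set V} => _.
have N0 : 0 < #|V|%:R :> R by rewrite -(pmulr_rgt0 _ qpos) (lt_le_trans ltr01 qN).
have once (C : {set V}) (b : R) : 0 <= b ->
    (forall X : {set V}, X \subset C -> c1 * #|V|%:R <= #|X|%:R ->
      containable good (fun I => (Fam I /\ I \subset C) /\ [disjoint I & X]) b) ->
    containable good (fun I => Fam I /\ I \subset C) (b + B * (q * #|V|%:R)).
  move=> b0 Hstop; have [gC|ngC] := boolP (good C).
    apply: (containable_leaf _ gC) => [|I []//].
    by rewrite addr_ge0 // mulr_ge0 ?(le_trans ler01 qN) // ltW.
  pose wC (E : {set V}) := if E \subset C then w E else 0.
  apply: (step V good C wC) => // [E|E|L L0||I [FI _] E EI].
  - by rewrite /wC; case: ifP.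
  - by rewrite /wC; case: ifP => [EC /wk->|]; rewrite ?eqxx.
  - by apply: le_trans (dw L L0); apply: ler_sum => E _; rewrite /wC; case: ifP.
  - by rewrite /wtotal /wC -big_mkcond leNgt.
  - by rewrite /wC FI ?if_same.
have iter j (C : {set V}) : #|C|%:R <= j%:R * (c1 * #|V|%:R) ->
    containable good (fun I => Fam I /\ I \subset C) (j.+1%:R * (B * (q * #|V|%:R))).
  elim: j C => [|j IHj] C Cj.
    (* Here [C] is empty and contains no [X] of positive size; this final round accounts for the
       successor in [j.+1]. *)
    rewrite mul1r -[B * _]add0r; apply: once => // X XC Xc1.
    have := mulr_gt0 c10 N0; rewrite ltNge => /negP[]; apply: le_trans Xc1 _.
    apply: (@le_trans _ _ #|C|%:R); first by rewrite ler_nat subset_leq_card.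
    by apply: le_trans Cj _; rewrite mul0r.
  rewrite -[j.+2]addn1 natrD mulrDl mul1r; apply: once => [|X XC Xc1].
    by rewrite mulr_ge0 // mulr_ge0 ?(le_trans ler01 qN) // ltW.
  apply: containable_sub (IHj (C :\: X) _) => // [I [[FI IC'] IX]|].
    by split=> //; rewrite subsetD IC'.
  move: Cj; rewrite cardsDS // natrB ?subset_leq_card // -natr1 mulrDl mul1r.
  by move: Xc1; clear; lra.
apply: containable_sub (iter m setT _) => [|I FI|]; [by rewrite mulrA|by rewrite subsetT|].
rewrite cardsT mulrA ler_peMl ?ler0n // -ler_pdivrMr // mul1r.
by rewrite ltW // /m archi_boundP // invr_ge0 ltW.
Qed.

(** * Supersaturation of transitive tournaments *)

(** The out- or the in-neighbourhood of [v] has at least [2 ^ r] points; [v] goes before a chain of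
    the first or after a chain of the second. [C] may hold in both directions, as containers need
    not be orientations. *)
Lemma transitive_seq (T : finType) (C : rel T) (r : nat) (A : {set T}) :
  (2 ^ r <= #|A|)%N ->
  {in A &, forall x y, x != y -> C x y || C y x} ->
  exists s, [/\ size s = r, uniq s, {subset s <= A} & pairwise C s].
Proof.
elim: r A => [|r IHr] A Ar AC; first by exists [::].
have [v vA] : exists v, v \in A.
  by apply/card_gt0P; apply: leq_trans Ar; rewrite expn_gt0.
pose O := [set x in A :\ v | C v x]; pose I := [set x in A :\ v | C x v].
have OA : O \subset A :\ v by apply/subsetP => x; rewrite inE => /andP[].
have IA : I \subset A :\ v by apply/subsetP => x; rewrite inE => /andP[].
have sub (B : {set T}) : B \subset A :\ v -> {in B &, forall x y, x != y -> C x y || C y x}.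
  move=> BA x y xB yB; apply: AC.
    by have /setD1P[] := subsetP BA x xB.
  by have /setD1P[] := subsetP BA y yB.
have AOI : (#|A :\ v| <= #|O| + #|I|)%N.
  apply: leq_trans (leq_card_setU O I); apply: subset_leq_card.
  apply/subsetP => x xA; rewrite !inE -!in_setD1 xA /=.
  by move: xA => /setD1P[xv xA]; apply: AC; rewrite 1?eq_sym.
have : (2 ^ r <= #|O|)%N || (2 ^ r <= #|I|)%N.
  rewrite (cardsD1 v A) vA expnS in Ar.
  by have := expn_gt0 2 r; rewrite /= -[(_ || _)]negbK negb_or -!ltnNge; lia.
case/orP => Br.
  have [s [sr us sB ps]] := IHr O Br (sub _ OA).
  exists (v :: s); split=> /=; first by rewrite sr.
  - by rewrite us andbT; apply/negP => /sB; rewrite !inE eqxx.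
  - by move=> x; rewrite inE => /predU1P[->//|/sB/(subsetP OA)/setD1P[]].
  - by rewrite ps andbT; apply/allP => x /sB; rewrite inE => /andP[].
have [s [sr us sB ps]] := IHr I Br (sub _ IA).
exists (rcons s v); split; first by rewrite size_rcons sr.
- by rewrite rcons_uniq us andbT; apply/negP => /sB; rewrite !inE eqxx.
- by move=> x; rewrite mem_rcons inE => /predU1P[->//|/sB/(subsetP IA)/setD1P[]].
- by rewrite pairwise_rcons ps andbT; apply/allP => x /sB; rewrite inE => /andP[].
Qed.

Lemma card_family_le (I T : finType) (F : I -> {set T}) (J : {set I}) (a b : nat) :
  (forall i, i \in J -> (#|F i| <= a)%N) -> (forall i, i \notin J -> (#|F i| <= b)%N) ->
  (#|family (fun i => mem (F i))| <= a ^ #|J| * b ^ (#|I| - #|J|))%N.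
Proof.
move=> Fa Fb; rewrite card_family foldrE big_image /=.
rewrite (bigID (mem J)) /=; apply: leq_mul.
  by rewrite -prod_nat_const; apply: leq_prod => i /Fa.
have -> : (#|I| - #|J|)%N = #|~: J| by rewrite [RHS]cardsCs setCK.
rewrite -prod_nat_const.
rewrite [leqRHS](eq_bigl (fun i => i \notin J)) => [|i]; last by rewrite inE.
by apply: leq_prod => i /Fb.
Qed.

(** The values on the image of [h] are fixed by an element of [Q]; the other coordinates are
    free. *)
Lemma card_reindex_le (I J T : finType) (h : J -> I) (Q : {set {ffun J -> T}}) :
  injective h ->
  (#|[set g : {ffun I -> T} | [ffun j => g (h j)] \in Q]| <= #|Q| * #|T| ^ (#|I| - #|J|))%N.
Proof.
move=> hinj.
pose S f := [set g : {ffun I -> T} | [ffun j => g (h j)] == f].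
have -> : [set g : {ffun I -> T} | [ffun j => g (h j)] \in Q] = \bigcup_(f in Q) S f.
  apply/setP => g; rewrite inE; apply/idP/bigcupP => [gQ|[f fQ]].
    by exists [ffun j => g (h j)]; rewrite ?inE.
  by rewrite inE => /eqP ->.
apply: leq_trans (unstable.card_big_setU _ _ _) _.
rewrite -sum_nat_const; apply: leq_sum => f _.
pose F i := [set x | [forall j, (h j == i) ==> (x == f j)]].
apply: (@leq_trans #|family (fun i => mem (F i))|).
  apply: subset_leq_card; apply/subsetP => g; rewrite inE => /eqP gf.
  apply/familyP => i; rewrite !inE; apply/forallP => j; apply/implyP => /eqP <-.
  by rewrite -gf ffunE.
rewrite -(card_imset (mem J) hinj) -[(_ ^ _)%N]mul1n -(exp1n #|h @: J|).
apply: card_family_le => [i /imsetP[j _ ->]|i _]; last exact: max_card.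
apply/card_le1_eqP => x y; rewrite !inE => /forallP/(_ j) + /forallP/(_ j).
by rewrite eqxx => /eqP -> /eqP ->.
Qed.

(** The order of ['I_r] serves as the transitive order, so a copy is a labelled one. *)
Definition tarcs (T : finType) (r : nat) (f : {ffun 'I_r -> T}) : {set T * T} :=
  [set (f ij.1, f ij.2) | ij : 'I_r * 'I_r & (ij.1 < ij.2)%N].

Definition tcopies (T : finType) (r : nat) (C : {set T * T}) : {set {ffun 'I_r -> T}} :=
  [set f : {ffun 'I_r -> T} | injectiveb f & tarcs f \subset C].

Definition missing (n : nat) (C : {set 'I_n * 'I_n}) : {set {set 'I_n}} :=
  [set e in pairs n | [forall u, forall v, (e == [set u; v]) ==> ((u, v) \notin C)]].

Lemma missing_pair n (C : {set 'I_n * 'I_n}) (x y : 'I_n) : x != y ->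
  (x, y) \notin C -> (y, x) \notin C -> [set x; y] \in missing C.
Proof.
move=> xy xyC yxC; rewrite !inE cards2 xy /=.
apply/forallP => u; apply/forallP => v; apply/implyP => /eqP E.
have : x \in [set u; v] by rewrite -E set21.
have : y \in [set u; v] by rewrite -E set22.
rewrite !inE => /orP[]/eqP yE /orP[]/eqP xE; rewrite -?yE -?xE //.
  by rewrite xE yE eqxx in xy.
by rewrite xE yE eqxx in xy.
Qed.

Lemma card_missing_arcs n (C : {set 'I_n * 'I_n}) :
  (#|[set xy : 'I_n * 'I_n | [set xy.1; xy.2] \in missing C]| <= 4 * #|missing C|)%N.
Proof.
have -> : [set xy : 'I_n * 'I_n | [set xy.1; xy.2] \in missing C]
    = \bigcup_(e in missing C) [set xy : 'I_n * 'I_n | [set xy.1; xy.2] == e].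
  apply/setP => xy; rewrite inE; apply/idP/bigcupP => [h|[e]].
    by exists [set xy.1; xy.2] => //; rewrite inE.
  by move=> eC; rewrite inE => /eqP ->.
apply: leq_trans (unstable.card_big_setU _ _ _) _.
rewrite mulnC -sum_nat_const; apply: leq_sum => e.
rewrite !inE => /andP[/eqP e2 _].
(* Both ends lie in [e]; the factor 4 is crude but enough. *)
rewrite (_ : 4 = #|setX e e|)%N; last by rewrite cardsX e2.
apply: subset_leq_card; apply/subsetP => -[x y]; rewrite !inE /= => /eqP <-.
by rewrite set21 set22.
Qed.

Lemma transitive_reindex (T : finType) (r M : nat) (C : {set T * T})
    (g : {ffun 'I_M -> T}) : (2 ^ r <= M)%N -> injective g ->
  (forall i j, i != j -> ((g i, g j) \in C) || ((g j, g i) \in C)) ->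
  exists2 h : {ffun 'I_r -> 'I_M}, injectiveb h &
    [ffun i => g (h i)] \in tcopies r C.
Proof.
move=> rM ginj gC.
have [||s [sr us _ /(pairwiseP _) ps]] :=
  @transitive_seq 'I_M (fun i j => (g i, g j) \in C) r setT.
- by rewrite cardsT card_ord.
- by move=> i j _ _; apply: gC.
have x0 : 'I_M by apply: (@Ordinal M 0); apply: leq_trans rM; rewrite expn_gt0.
have hinj : injective (fun i : 'I_r => nth x0 s i).
  by move=> i j /eqP; rewrite nth_uniq ?sr ?ltn_ord // => /eqP /val_inj.
exists [ffun i : 'I_r => nth x0 s i].
  by apply/injectiveP => i j; rewrite !ffunE; apply: hinj.
rewrite inE; apply/andP; split.
  by apply/injectiveP => i j; rewrite !ffunE => /ginj /hinj.
apply/subsetP => _ /imsetP[[i j] /= ij ->]; rewrite !ffunE.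
by rewrite inE /= in ij; apply: (ps x0) => //; rewrite inE sr ltn_ord.
Qed.

(** All maps [g] from ['I_M] to ['I_n] are counted. Either two indices go to equal points or to a
    missing pair (first term: [n] for the diagonal), or any two image points are joined by an arc of
    [C] and [g] restricts to a transitive copy (second term). *)
Lemma supersaturation_count (n r M : nat) (C : {set 'I_n * 'I_n}) :
  (2 ^ r <= M)%N ->
  (n ^ M <= M ^ 2 * ((n + 4 * #|missing C|) * n ^ (M - 2))
            + M ^ r * (#|tcopies r C| * n ^ (M - r)))%N.
Proof.
move=> rM.
pose Bad := [set xy : 'I_n * 'I_n | (xy.1 == xy.2) || ([set xy.1; xy.2] \in missing C)].
have BadLe : (#|Bad| <= n + 4 * #|missing C|)%N.
  have -> : Bad = [set (x, x) | x : 'I_n] :|: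
      [set xy : 'I_n * 'I_n | [set xy.1; xy.2] \in missing C].
    apply/setP => -[x y]; rewrite in_setU [in LHS]inE /=; congr (_ || _); last first.
      by rewrite [RHS](finset.in_set
        (fun xy : 'I_n * 'I_n => [set xy.1; xy.2] \in missing C)).
    by apply/eqP/imsetP => [->|[z _ [-> ->]] //]; exists y.
  rewrite cardsU; apply: leq_trans (leq_subr _ _) _; apply: leq_add _ (card_missing_arcs C).
  by apply: leq_trans (leq_imset_card _ _) _; rewrite card_ord.
pose A (ij : 'I_M * 'I_M) := [set g : {ffun 'I_M -> 'I_n} |
  (ij.1 != ij.2) && ((g ij.1, g ij.2) \in Bad)].
pose B (h : {ffun 'I_r -> 'I_M}) := [set g : {ffun 'I_M -> 'I_n} |
  injectiveb h && ([ffun i => g (h i)] \in tcopies r C)].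
have cover : [set: {ffun 'I_M -> 'I_n}] \subset (\bigcup_ij A ij) :|: (\bigcup_h B h).
  apply/subsetP => g _; rewrite in_setU; apply/orP.
  have [/bigcupP ?|nA] := boolP (g \in \bigcup_ij A ij); first by left.
  right; have gA i j : i != j -> (g i, g j) \notin Bad.
    by move=> ij; apply: contra nA => gB; apply/bigcupP; exists (i, j); rewrite // inE ij.
  have ginj : injective g.
    move=> i j gij; apply/eqP; apply: contraT => /gA; rewrite inE /= gij eqxx //.
  have [h hinj hC] : exists2 h : {ffun 'I_r -> 'I_M},
      injectiveb h & [ffun i => g (h i)] \in tcopies r C.
    apply: transitive_reindex => // i j ij; apply: contraT; rewrite negb_or => /andP[c1 c2].
    have := gA i j ij; rewrite inE /= missing_pair ?orbT //.
    by apply: contra ij => /eqP/ginj ->.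
  by apply/bigcupP; exists h; rewrite // inE hinj.
have := subset_leq_card cover; rewrite cardsT card_ffun !card_ord => /leq_trans; apply.
rewrite cardsU; apply: leq_trans (leq_subr _ _) _; apply: leq_add.
  apply: leq_trans (unstable.card_big_setU _ _ _) _.
  rewrite (_ : M ^ 2 = #|{: 'I_M * 'I_M}|)%N; last by rewrite card_prod card_ord mulnn.
  rewrite -sum_nat_const; apply: leq_sum => -[i j] _; rewrite /A /=.
  have [->|ij] := eqVneq i j.
    by rewrite (_ : [set _ | _] = set0) ?cards0 //; apply/setP => g; rewrite !inE.
  pose h b := if b then i else j.
  have hinj : injective h by case=> -[] //= /eqP; rewrite ?(negbTE ij) // eq_sym (negbTE ij).
  pose Q := [set f : {ffun bool -> 'I_n} | (f true, f false) \in Bad].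
  apply: (@leq_trans (#|Q| * n ^ (M - 2))).
    have := card_reindex_le Q hinj; rewrite !card_ord card_bool; apply: leq_trans.
    by apply: subset_leq_card; apply/subsetP => g; rewrite !inE !ffunE.
  rewrite leq_mul2r; apply/orP; right; apply: leq_trans BadLe.
  rewrite -(card_in_imset (f := fun f : {ffun bool -> 'I_n} => (f true, f false))).
    by apply: subset_leq_card; apply/subsetP => _ /imsetP[f + ->]; rewrite inE.
  by move=> f f' _ _ [ft ff]; apply/ffunP => -[].
apply: leq_trans (unstable.card_big_setU _ _ _) _.
rewrite (_ : M ^ r = #|{: {ffun 'I_r -> 'I_M}}|)%N; last by rewrite card_ffun !card_ord.
rewrite -(sum_nat_const {: {ffun 'I_r -> 'I_M}}); apply: leq_sum => h _; rewrite /B.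
have [/injectiveP hinj|] := boolP (injectiveb h).
  by have := card_reindex_le (tcopies r C) hinj; rewrite !card_ord.
by rewrite (_ : [set _ | _] = set0) ?cards0 //; apply/setP => g; rewrite !inE.
Qed.

(** In [supersaturation_count], the copies account for at most a quarter of [n ^ M] and, as
    [4 * M ^ 2 <= n], the diagonal for another quarter. Missing pairs must supply the remaining
    half. *)
Lemma supersaturation (n r M : nat) (C : {set 'I_n * 'I_n}) :
  (0 < r)%N -> (2 ^ r <= M)%N -> (4 * M ^ 2 <= n)%N ->
  (4 * M ^ r * #|tcopies r C| <= n ^ r)%N ->
  (n ^ 2 <= 8 * M ^ 2 * #|missing C|)%N.
Proof.
move=> r0 rM Mn few.
have M2 : (2 <= M)%N by apply: leq_trans rM; rewrite -{1}(expn1 2) leq_exp2l.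
have rM' : (r <= M)%N by apply: leq_trans rM; exact/ltnW/ltn_expl.
have n0 : (0 < n)%N by apply: leq_trans Mn; rewrite muln_gt0 expn_gt0 (leq_trans _ M2).
have := supersaturation_count C rM.
have : (4 * (M ^ r * (#|tcopies r C| * n ^ (M - r))) <= n ^ M)%N.
  by rewrite -[X in (_ <= n ^ X)%N](subnKC rM') expnD !mulnA leq_mul2r few orbT.
have E : (n ^ M = n ^ 2 * n ^ (M - 2))%N by rewrite -expnD subnKC.
have x0 : (0 < n ^ (M - 2))%N by rewrite expn_gt0 n0.
rewrite {}E => h1 h2.
have h3 : (3 * n ^ 2 * n ^ (M - 2) <= 4 * (M ^ 2 * (n + 4 * #|missing C|)) * n ^ (M - 2))%N.
  by move: h1 h2; clear; rewrite !mulnA; lia.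
move: h3; rewrite leq_pmul2r // => h3.
have : (4 * M ^ 2 * n <= n ^ 2)%N by rewrite -mulnn leq_mul2r Mn orbT.
by move: h3; clear; rewrite -!mulnA; lia.
Qed.

(** * Codegrees of transitive copies and the resulting containers *)

Definition verts (T : finType) (L : {set T * T}) : {set T} :=
  [set xy.1 | xy in L] :|: [set xy.2 | xy in L].

Lemma verts_sub (T : finType) (r : nat) (f : {ffun 'I_r -> T}) (L : {set T * T}) :
  L \subset tarcs f -> verts L \subset f @: setT.
Proof.
move=> /subsetP Lf; apply/subsetP => x; rewrite in_setU.
by case/orP => /imsetP[xy /Lf /imsetP[ij _ ->] ->] /=; apply: imset_f.
Qed.

(** A tournament has one arc per pair, so forgetting directions is injective on [L]. *)
Lemma card_verts (T : finType) (r : nat) (f : {ffun 'I_r -> T}) (L : {set T * T}) :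
  injective f -> L \subset tarcs f -> (#|L| <= 'C(#|verts L|, 2))%N.
Proof.
move=> finj Lf; rewrite -cards_draws.
pose pr (xy : T * T) := [set xy.1; xy.2].
have arc x y : (x, y) \in L -> exists i j : 'I_r, [/\ (i < j)%N, x = f i & y = f j].
  move=> /(subsetP Lf)/imsetP[[i j]] /=; rewrite inE /= => ij [-> ->].
  by exists i, j.
rewrite -(@card_in_imset _ _ pr).
  apply: subset_leq_card; apply/subsetP => _ /imsetP[[x y] xyL ->].
  rewrite inE; apply/andP; split.
    by rewrite /pr subUset !sub1set !in_setU /= (imset_f fst xyL) (imset_f snd xyL) orbT.
  have [i [j [ij -> ->]]] := arc _ _ xyL.
  by rewrite /pr /= cards2 (inj_eq finj) neq_ltn ij.
move=> [x y] [x' y'] /arc[i [j [ij -> ->]]] /arc[i' [j' [ij' -> ->]]].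
rewrite /pr /= => E.
have : f i \in [set f i'; f j'] by rewrite -E set21.
have : f j \in [set f i'; f j'] by rewrite -E set22.
rewrite !inE !(inj_eq finj) => /orP[]/eqP e1 /orP[]/eqP e2; subst => //.
- by rewrite ltnn in ij.
- by move: ij ij'; lia.
- by rewrite ltnn in ij.
Qed.

(** Choose one preimage of each point of [W]; these form a set [J] of [#|W|] indices. There are at
    most [2 ^ r] such [J] and [#|W| ^ #|W|] maps from [J] into [W], and the other indices are
    free. *)
Lemma count_copies_through (T : finType) (r : nat) (W : {set T}) :
  (#|[set f : {ffun 'I_r -> T} | W \subset f @: setT]|
     <= 2 ^ r * (#|W| ^ #|W| * #|T| ^ (r - #|W|)))%N.
Proof.
pose S (J : {set 'I_r}) := [set f : {ffun 'I_r -> T} | (#|J| == #|W|) && (f @: J \subset W)].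
apply: (@leq_trans #|\bigcup_J S J|).
  apply: subset_leq_card; apply/subsetP => f; rewrite inE => /subsetP Wf.
  have r0 (x : T) : x \in W -> {i | f i = x}.
    by move=> /Wf /imsetP/cid2[i _ ->]; exists i.
  have [g gP] : exists g : T -> option 'I_r,
      {in W, forall x, exists2 i, g x = Some i & f i = x}.
    exists (fun x => [pick i | f i == x]) => x xW; case: pickP => [i /eqP fi|none].
      by exists i.
    by have [i fi] := r0 x xW; have := none i; rewrite fi eqxx.
  pose J := [set i | Some i \in g @: W].
  apply/bigcupP; exists J => //; rewrite inE; apply/andP; split.
    have fJ : {in J &, injective f}.
      move=> i j; rewrite !inE => /imsetP[x xW gx] /imsetP[y yW gy] fij.
      have [i' gx' fx] := gP x xW; have [j' gy' fy] := gP y yW.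
      move: gx gy; rewrite gx' gy' => -[ei] [ej].
      move: fij; rewrite ei ej fx fy => exy.
      by move: gx'; rewrite exy gy' => -[->].
    rewrite -(card_in_imset fJ) (_ : f @: J = W) //; apply/setP => x.
    apply/imsetP/idP => [[i]|xW].
      by rewrite inE => /imsetP[y yW gy]; have [j] := gP y yW; rewrite -gy => -[<-] -> ->.
    have [i gx fx] := gP x xW; exists i => //.
    by rewrite inE -gx imset_f.
  apply/subsetP => x /imsetP[i]; rewrite inE => /imsetP[y yW gy] ->.
  by have [j] := gP y yW; rewrite -gy => -[<-] ->.
apply: leq_trans (unstable.card_big_setU _ _ _) _.
have -> : (2 ^ r = #|{: {set 'I_r}}|)%N.
  by rewrite -[in RHS]cardsT -powersetT card_powerset cardsT card_ord.
rewrite -(sum_nat_const {: {set 'I_r}}).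
apply: leq_sum => J _; rewrite /S.
have [JW|JW] := eqVneq #|J| #|W|; last first.
  by rewrite (_ : [set _ | _] = set0) ?cards0 //; apply/setP => f; rewrite !inE.
pose F i := if i \in J then W else setT.
have := @card_family_le _ _ F J #|W| #|T|; rewrite card_ord JW => H.
apply: leq_trans _ (H _ _) => [|i iJ|i iJ]; last 2 first.
- by rewrite /F iJ.
- by rewrite max_card.
apply: subset_leq_card; apply/subsetP => f; rewrite inE /= => /subsetP fJ.
apply/familyP => i; rewrite /F; case: ifP => iJ; last by rewrite inE.
by apply: fJ; apply: imset_f.
Qed.

Lemma sum_card_fibers (S T : finType) (t : S -> T) (Q : pred S) (P : pred T) :
  (\sum_(E | P E) #|[set f | Q f & t f == E]| = #|[set f | Q f & P (t f)]|)%N.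
Proof.
rewrite -[RHS]sum1_card (partition_big t P) /=; last first.
  by move=> f; rewrite inE => /andP[].
apply: eq_bigr => E PE; rewrite -sum1_card; apply: eq_bigl => f.
by rewrite !inE; case: eqP => [->|]; rewrite ?PE ?andbF ?andbT.
Qed.

(** This is where the threshold enters. After squaring and substituting [x ^+ 2 = q ^- r.+1], the
    exponents to compare are [(v - 2)(r + 1)] and [(v - 2)(v + 1)], and [v <= r]. *)
Lemma codegree_exponent (R : realFieldType) (r v : nat) (q x : R) :
  0 < q -> q <= 1 -> 0 < x -> q ^+ r.+1 * x ^+ 2 = 1 -> (2 <= v <= r)%N ->
  x ^+ 2 / x ^+ v <= q ^+ 'C(v, 2).-1.
Proof.
move=> q0 q1 x0 qx; case: v => [//|[//|u]] /= ur.
rewrite -[u.+2]addn2 exprD invfM mulrC -mulrA mulVf ?mulr1 ?expf_neq0 ?gt_eqF //.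
have C2 : (('C(u + 2, 2).-1).*2 = u * (u + 3))%N.
  by have := mul_bin_diag u.+2 1; rewrite bin1 addn2 /=; nia.
rewrite -(@ler_pXn2r _ 2) ?nnegrE ?invr_ge0 ?exprn_ge0 ?(ltW x0) ?(ltW q0) //.
rewrite -exprM muln2 C2 exprVn -exprM mulnC exprM.
have -> : x ^+ 2 = (q ^+ r.+1)^-1.
  by apply: (mulfI (lt0r_neq0 (exprn_gt0 r.+1 q0))); rewrite qx mulfV // expf_neq0 // gt_eqF.
rewrite exprVn invrK -exprM mulnC; apply: ler_wiXn2l; rewrite ?(ltW q0) //.
by rewrite leq_mul2l; lia.
Qed.

Lemma card_tarcs (T : finType) (r : nat) (f : {ffun 'I_r -> T}) : injective f ->
  #|tarcs f| = #|[set ij : 'I_r * 'I_r | (ij.1 < ij.2)%N]|.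
Proof.
by move=> finj; rewrite card_imset // => -[i j] [i' j'] /= [/finj -> /finj ->].
Qed.

Lemma transitive_containers (R : realType) (r : nat) (eps : R) :
  (0 < r)%N -> 0 < eps -> exists B q0 : R, [/\ 0 < B, 0 < q0 &
  forall (n : nat) (q : R), (0 < n)%N -> 0 < q -> q <= q0 -> q <= 1 ->
  q ^+ r.+1 * n%:R ^+ 2 = 1 -> 1 <= q * n%:R ^+ 2 ->
  containable
    (fun C : {set 'I_n * 'I_n} => #|tcopies r C|%:R < eps * n%:R ^+ r)
    (fun I => tcopies r I = set0) (B * (q * n%:R ^+ 2))].
Proof.
move=> rpos eps0.
(* The constant of [count_copies_through], with [#|W| <= r]. *)
pose K : R := 2 ^+ r * r%:R ^+ r.
have K0 : 0 < K by rewrite mulr_gt0 // exprn_gt0 // ltr0n.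
have [B [q0 [B0 q00 main]]] := container_theorem
  #|[set ij : 'I_r * 'I_r | (ij.1 < ij.2)%N]| K0 eps0.
exists B, q0; split=> // n q n0 qpos qq0 q1 qn qN.
have N0 : 0 < n%:R :> R by rewrite ltr0n.
(* With this scaling the at most [n ^ r] copies weigh at most [n ^ 2], the number of vertices of the
   hypergraph. *)
pose a : R := n%:R ^+ 2 / n%:R ^+ r.
have a0 : 0 < a by rewrite divr_gt0 // exprn_gt0.
pose w (E : {set 'I_n * 'I_n}) : R :=
  #|[set f : {ffun 'I_r -> 'I_n} | injectiveb f & tarcs f == E]|%:R * a.
have VE : #|{: 'I_n * 'I_n}|%:R = n%:R ^+ 2 :> R.
  by rewrite card_prod card_ord -natrX mulnn.
have sumw (P : pred {set 'I_n * 'I_n}) : \sum_(E | P E) w E =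
    #|[set f : {ffun 'I_r -> 'I_n} | injectiveb f & P (tarcs f)]|%:R * a.
  by rewrite -mulr_suml -natr_sum sum_card_fibers.
have := main _ w q qpos qq0; rewrite VE => /(_ qN).
case=> [E|E|L L0|Cf CfP].
- by rewrite mulr_ge0 ?ler0n // ltW.
- rewrite mulf_eq0 negb_or pnatr_eq0 cards_eq0 => /andP[/set0Pn[f] + _].
  by rewrite inE => /andP[/injectiveP /card_tarcs <- /eqP ->].
- rewrite /wdeg sumw.
  have [->|/set0Pn[f0]] := eqVneq
    [set f : {ffun 'I_r -> 'I_n} | injectiveb f & L \subset tarcs f] set0.
    by rewrite cards0 mul0r mulr_ge0 ?exprn_ge0 ?ltW.
  rewrite inE => /andP[/injectiveP f0inj Lf0].
  pose v := #|verts L|.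
  have Lv : (#|L| <= 'C(v, 2))%N := card_verts f0inj Lf0.
  have v2 : (2 <= v)%N.
    rewrite leqNgt; apply: contra L0 => v2; rewrite -cards_eq0 -leqn0.
    by rewrite -(@bin_small v 2).
  have vr : (v <= r)%N.
    apply: leq_trans (subset_leq_card (verts_sub Lf0)) _.
    by apply: leq_trans (leq_imset_card _ _) _; rewrite cardsT card_ord.
  apply: (@le_trans _ _ (K * (n%:R ^+ 2 / n%:R ^+ v))).
    have cnt : (#|[set f : {ffun 'I_r -> 'I_n} | injectiveb f & L \subset tarcs f]|
        <= 2 ^ r * (r ^ r * n ^ (r - v)))%N.
      apply: (@leq_trans #|[set f : {ffun 'I_r -> 'I_n} | verts L \subset f @: setT]|).
        by apply: subset_leq_card; apply/subsetP => f; rewrite !inE => /andP[_ /verts_sub].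
      apply: leq_trans (count_copies_through _ _) _; rewrite card_ord -/v.
      rewrite leq_mul2l leq_mul2r; apply/orP; right; apply/orP; right.
      apply: (@leq_trans (r ^ v)); first by rewrite leq_exp2r // (ltn_trans _ v2).
      by rewrite leq_pexp2l.
    apply: (@le_trans _ _ ((2 ^ r * (r ^ r * n ^ (r - v)))%:R * a)).
      by rewrite ler_pM2r // ler_nat.
    rewrite !natrM !natrX mulrA -/K -[leLHS]mulrA ler_pM2l // /a.
    rewrite -[X in _ / n%:R ^+ X](subnK vr) exprD.
    rewrite [leLHS](_ : _ = n%:R ^+ 2 / n%:R ^+ v) //.
    by field; rewrite !expf_neq0 ?gt_eqF.
  rewrite ler_pM2l //; apply: le_trans (codegree_exponent qpos q1 N0 qn _) _.
    by rewrite v2 vr.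
  (* Since [q <= 1], the bound [#|L| <= 'C(v, 2)] turns the exponent into [#|L|.-1]. *)
  apply: ler_wiXn2l; rewrite ?(ltW qpos) //.
  by rewrite -ltnS !prednK ?bin_gt0 // ?card_gt0.
exists Cf => I I0; have [|F [FI Fb FP]] := CfP I.
  move=> E EI; apply/eqP; rewrite mulf_eq0 pnatr_eq0 cards_eq0; apply/orP; left.
  apply: contraT => /set0Pn[f]; rewrite inE => /andP[fi /eqP fE].
  have fI : f \in tcopies r I by rewrite inE; apply/andP; split=> //; rewrite fE.
  by rewrite I0 inE in fI.
exists F; split=> // F' FF' F'I; have [IC gC] := FP F' FF' F'I; split=> //.
move: gC; rewrite sumw /a mulrA ltr_pdivrMr ?exprn_gt0 //.
rewrite mulrAC ltr_pM2r ?exprn_gt0 //.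
Qed.

(** * Probability estimates in the random graph *)

Lemma gnp_weight_ge0 (R : realType) (n : nat) (q : R) (G : {set {set 'I_n}}) :
  0 <= q <= 1 -> 0 <= gnp_weight q G.
Proof.
move=> /andP[q0 q1]; apply: prodr_ge0 => e _; case: ifP => _ //.
by rewrite subr_ge0.
Qed.

(** Expanding the product of [F e + F' e] gives a sum over graphs, where [F] weighs a present and
    [F'] an absent edge. Setting [F] to 0 on [T] and [F'] to 0 on [S] keeps the wanted graphs, and
    the product is then evaluated factor by factor. *)
Lemma gnp_prob_sub_disjoint (R : realType) (n : nat) (q : R)
    (S T : {set {set 'I_n}}) :
  0 <= q <= 1 -> S \subset pairs n -> T \subset pairs n ->
  gnp_prob q (fun G => (S \subset G) && [disjoint T & G])
    <= q ^+ #|S| * (1 - q) ^+ #|T|.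
Proof.
move=> /andP[q0 q1] SP TP; have q1' : 0 <= 1 - q by rewrite subr_ge0.
pose F e : R := if (e \in pairs n) && (e \notin T) then q else 0.
pose F' e : R := if e \in pairs n then (if e \in S then 0 else 1 - q) else 1.
have F0 e : 0 <= F e by rewrite /F; case: ifP.
have F'0 e : 0 <= F' e by rewrite /F'; case: ifP => //; case: ifP.
apply: (@le_trans _ _ (\prod_e (F e + F' e))).
  rewrite bigA_distr /= [leRHS](bigID (fun G : {set {set 'I_n}} =>
    (G \subset pairs n) && ((S \subset G) && [disjoint T & G]))) /=.
  apply: ler_wpDr.
    by apply: sumr_ge0 => G _; apply: prodr_ge0 => e _; case: ifP.
  apply: ler_sum => G /andP[GP /andP[SG TG]].
  rewrite /gnp_weight big_mkcond /=; apply: ler_prod => e _.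
  apply/andP; split; first by case: ifP => // _; case: ifP.
  rewrite /F /F'; have [eG|eG] := boolP (e \in G).
    by rewrite (subsetP GP e eG) (disjointFl TG eG).
  by case: ifP => // eP; rewrite ifN //; apply: contra eG => /(subsetP SG).
rewrite -[X in _ <= X * _]prodr_const -[X in _ <= _ * X]prodr_const.
rewrite [X in _ <= X * _]big_mkcond [X in _ <= _ * X]big_mkcond /= -big_split /=.
apply: ler_prod => e _; rewrite addr_ge0 //=.
rewrite /F /F'; have [eS|eS] := boolP (e \in S).
  rewrite (subsetP SP e eS) /= addr0; case: ifP => /=; first by move=> /negbTE ->; rewrite mulr1.
  by move=> /negbFE ->; rewrite mulr_ge0.
have [eT|eT] := boolP (e \in T); first by rewrite (subsetP TP e eT) /= add0r mul1r.
by rewrite andbT mulr1; case: ifP => _; rewrite ?add0r // subrKC.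
Qed.

Lemma gnp_prob_le_sum (R : realType) (n : nat) (q : R) (I : finType)
    (P : pred I) (A : pred {set {set 'I_n}}) (B : I -> pred {set {set 'I_n}}) :
  0 <= q <= 1 ->
  (forall G : {set {set 'I_n}}, G \subset pairs n -> A G -> exists2 i, P i & B i G) ->
  gnp_prob q A <= \sum_(i | P i) gnp_prob q (B i).
Proof.
move=> q01 AB; have w0 G := gnp_weight_ge0 G q01.
rewrite /gnp_prob (exchange_big_dep (fun G : {set {set 'I_n}} => G \subset pairs n)) /=;
  last by move=> i G _ /andP[].
rewrite big_mkcondr /=; apply: ler_sum => G GP; case: ifP => [AG|_].
  have [i Pi BiG] := AB G GP AG; rewrite (bigD1 i) /= ?Pi ?GP ?BiG //.
  by rewrite lerDl sumr_ge0.
exact: sumr_ge0.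
Qed.

Lemma gnp_prob_predC (R : realType) (n : nat) (q : R) (A : pred {set {set 'I_n}}) :
  gnp_prob q A = 1 - gnp_prob q (predC A).
Proof.
apply/eqP; rewrite eq_sym subr_eq -(gnp_prob_total n q) /gnp_prob.
rewrite (bigID A) /=; apply/eqP; congr (_ + _); apply: eq_bigl => G; by rewrite andbT.
Qed.

Lemma sum_expr_card (R : comNzRingType) (V : finType) (x : R) :
  \sum_(F : {set V}) x ^+ #|F| = (x + 1) ^+ #|V|.
Proof.
rewrite -prodr_const bigA_distr /=; apply: eq_bigr => F _.
by rewrite -prodr_const big_mkcond.
Qed.

(** * From orientations to the union bound over fingerprints *)

Lemma orientation_tcopies0 (n r : nat) (G : {set {set 'I_n}}) (D : {set 'I_n * 'I_n}) :
  G \subset pairs n -> is_orientation G D -> ~~ has_transitive_clique r G D ->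
  tcopies r D = set0.
Proof.
move=> GP /andP[/forallP DG /forallP GD] noT; apply/setP => f; rewrite in_set0.
apply: contraNF noT; rewrite inE => /andP[/injectiveP finj /subsetP fD].
have arcD (i j : 'I_r) : (i < j)%N -> (f i, f j) \in D.
  by move=> ij; apply: fD; apply/imsetP; exists (i, j); rewrite ?inE.
have DE u v : (u, v) \in D -> [set u; v] \in G.
  by have /forallP /(_ v) /implyP := DG u.
(* A backward arc would give one edge both directions, and a loop is not an edge. *)
have Dlt i j : (f i, f j) \in D -> (i < j)%N.
  move=> Dij; have Gij := DE _ _ Dij; case: ltngtP => // ij.
    have /forallP /(_ (f j)) /implyP /(_ Gij) := GD (f i).
    by rewrite Dij (arcD j i ij).
  have := subsetP GP _ Gij; rewrite inE (val_inj ij) cards2 eqxx.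
  by [].
apply/existsP; exists (f @: setT); apply/and3P; split.
- by rewrite card_imset // cardsT card_ord.
- apply/forall_inP => _ /imsetP[i _ ->]; apply/forall_inP => _ /imsetP[j _ ->].
  apply/implyP => fij; have [ij|ij|ij] := ltngtP i j.
  + exact/DE/arcD.
  + by rewrite setUC; exact/DE/arcD.
  + by rewrite (val_inj ij) eqxx in fij.
apply/forall_inP => _ /imsetP[i _ ->]; apply/forall_inP => _ /imsetP[j _ ->].
apply/forall_inP => _ /imsetP[k _ ->]; apply/implyP => /Dlt ij; apply/implyP => /Dlt jk.
exact: arcD (ltn_trans ij jk).
Qed.

Definition underlying (n : nat) (F : {set 'I_n * 'I_n}) : {set {set 'I_n}} :=
  [set [set xy.1; xy.2] | xy in F].

(** An edge carries only one arc of [D]. Thus a fingerprint forces [#|F|] distinct edges, which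
    gives the factor [p ^+ #|F|] in the union bound. *)
Lemma card_underlying (n : nat) (G : {set {set 'I_n}}) (D F : {set 'I_n * 'I_n}) :
  G \subset pairs n -> is_orientation G D -> F \subset D ->
  underlying F \subset G /\ #|underlying F| = #|F|.
Proof.
move=> GP /andP[/forallP DG /forallP GD] /subsetP FD.
have DE u v : (u, v) \in D -> [set u; v] \in G.
  by have /forallP /(_ v) /implyP := DG u.
split; first by apply/subsetP => _ /imsetP[[u v] /FD uv ->]; apply: DE.
apply: card_in_imset => -[u v] [u' v'] /FD uv /FD uv' /= E.
have Guv := DE _ _ uv.
have irr x : (x, x) \in D -> False.
  by move=> /DE /(subsetP GP); rewrite inE cards2 eqxx.
have : u' \in [set u; v] by rewrite E set21.
have : v' \in [set u; v] by rewrite E set22.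
rewrite !inE => /orP[]/eqP ev /orP[]/eqP eu; rewrite {}ev {}eu in uv' E *.
- by case: (irr u).
- have /forallP /(_ v) /implyP /(_ Guv) := GD u.
  by rewrite uv uv'.
- by [].
- by case: (irr v).
Qed.

Lemma missing_disjoint (n : nat) (G : {set {set 'I_n}}) (D C : {set 'I_n * 'I_n}) :
  is_orientation G D -> D \subset C -> [disjoint missing C & G].
Proof.
move=> /andP[_ /forallP GD] /subsetP DC; apply/pred0P => e /=; apply/negP.
rewrite !inE -andbA => /and3P[/cards2P[u [v [_ ue]]] /forallP miss eG]; subst e.
have /forallP /(_ v) /implyP /(_ eG) := GD u.
have nC x y : [set u; v] == [set x; y] -> (x, y) \notin D.
  move=> exy; have /forallP /(_ y) /implyP /(_ exy) := miss x.
  exact: contra (DC _).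
by rewrite (negbTE (nC u v _)) ?(negbTE (nC v u _)) // setUC.
Qed.

(** The constraint [#|F| <= b] is replaced by the factor [expR (L * (b - #|F|))], which is at least
    1. The sum over all [F] is then a binomial expansion, at most
    [expR (L * b + expR (- L) * p * n ^ 2)]. *)
Lemma prob_failure_le (R : realType) (n r : nat) (p b L d : R)
    (good : pred {set 'I_n * 'I_n}) :
  0 <= p <= 1 -> 0 <= L ->
  containable good (fun I => tcopies r I = set0) b ->
  (forall C, good C -> d * n%:R ^+ 2 <= #|missing C|%:R) ->
  gnp_prob p (predC (@every_orientation_has_transitive_clique n r))
    <= expR (L * b + (expR (- L) - d) * (p * n%:R ^+ 2)).
Proof.
move=> p01 L0 [Cf CfP] miss; have /andP[p0 p1] := p01.
pose P (F : {set 'I_n * 'I_n}) := [&& #|F|%:R <= b, underlying F \subset pairs n,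
  #|underlying F| == #|F| & good (Cf F)].
pose B (F : {set 'I_n * 'I_n}) (G : {set {set 'I_n}}) :=
  (underlying F \subset G) && [disjoint missing (Cf F) & G].
apply: (@le_trans _ _ (\sum_(F | P F) gnp_prob p (B F))).
  apply: gnp_prob_le_sum => // G GP /forallPn[D]; rewrite negb_imply => /andP[GD noT].
  have [F [FD Fb FP]] := CfP D (orientation_tcopies0 GP GD noT).
  have [DC gC] := FP F (subxx F) FD.
  have [FG cF] := card_underlying GP GD FD.
  exists F; last by rewrite /B FG (missing_disjoint GD DC).
  by rewrite /P Fb (subset_trans FG GP) cF eqxx gC.
apply: (@le_trans _ _ (\sum_(F : {set 'I_n * 'I_n}) (expR (- L) * p) ^+ #|F| *
    (expR (L * b) * expR (- (d * (p * n%:R ^+ 2)))))).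
  rewrite [leRHS](bigID P) /=; apply: ler_wpDr.
    apply: sumr_ge0 => F _; rewrite !mulr_ge0 ?expR_ge0 //.
    by rewrite exprn_ge0 // mulr_ge0 ?expR_ge0.
  apply: ler_sum => F /and4P[Fb FP /eqP cF gF].
  have missP : missing (Cf F) \subset pairs n by apply/subsetP => e; rewrite inE => /andP[].
  apply: le_trans (gnp_prob_sub_disjoint p01 FP missP) _.
  rewrite cF exprMn [leRHS](_ : _ = expR (- L) ^+ #|F| * expR (L * b) * p ^+ #|F| *
    expR (- (d * (p * n%:R ^+ 2)))); last by ring.
  apply: ler_pM.
  - by rewrite exprn_ge0.
  - by rewrite exprn_ge0 // subr_ge0.
  - rewrite -[leLHS]mul1r; apply: ler_wpM2r; first by rewrite exprn_ge0.
    rewrite -[leLHS]expR0 -expRM_natl -expRD ler_expR mulrN addrC subr_ge0 mulrC.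
    exact: ler_wpM2l.
  (* Here [1 - p <= expR (- p)], and there are at least [d * n ^ 2] missing pairs. *)
  - apply: (@le_trans _ _ (expR (- p) ^+ #|missing (Cf F)|)).
      by apply: lerXn2r; rewrite ?nnegrE ?expR_ge0 ?subr_ge0 //; apply: expR_ge1Dx.
    rewrite -expRM_natl ler_expR mulrN lerN2 mulrCA mulrC.
    by apply: ler_wpM2r => //; apply: miss.
rewrite -mulr_suml sum_expr_card card_prod card_ord.
rewrite mulrBl expRD expRD.
rewrite [leLHS]mulrCA; apply: ler_wpM2l; first exact: expR_ge0.
apply: ler_wpM2r; first exact: expR_ge0.
rewrite -natrX -mulnn mulrA [_ * (n * n)%:R]mulrC expRM_natl.
apply: lerXn2r; rewrite ?nnegrE ?expR_ge0 ?addr_ge0 ?mulr_ge0 ?expR_ge0 //.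
by rewrite addrC expR_ge1Dx.
Qed.

(** * The threshold and the conclusion *)

Lemma threshold_power (R : realType) (n r : nat) : (0 < n)%N -> (0 < r)%N ->
  let q : R := n%:R `^ (- (2%:R / (r + 1)%:R)) in
  [/\ 0 < q, q <= 1, q ^+ r.+1 * n%:R ^+ 2 = 1 & n%:R <= q * n%:R ^+ 2].
Proof.
move=> n0 r0 /=; set q := _ `^ _.
have N1 : 1 <= n%:R :> R by rewrite ler1n.
have N0 : 0 < n%:R :> R by rewrite ltr0n.
have q0 : 0 < q by rewrite powR_gt0.
have E : q ^+ r.+1 * n%:R ^+ 2 = 1.
  rewrite -powR_mulrn ?powR_ge0 // /q -powRrM.
  rewrite addn1 mulNr divfK ?pnatr_eq0 //.
  by rewrite powRN powR_mulrn ?ltW // mulVf // expf_neq0 // gt_eqF.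
split=> //.
  rewrite -(powRr0 n%:R); apply: ler_powR => //.
have : n%:R `^ (- 1) <= q.
  apply: ler_powR => //; rewrite lerN2 ler_pdivrMr ?ltr0n ?addn1 // mul1r ler_nat.
  by rewrite ltnS.
rewrite powR_inv1 ?ler0n // => h.
rewrite expr2 mulrA ler_peMl ?ler0n // -ler_pdivrMr // mul1r //.
Qed.

Theorem theorem7p1 (R : realType) (r : nat) (p : nat -> R)
    (hr : (3 <= r)%N)
    (p01 : forall n : nat, 0 <= p n <= 1)
    (hp : much_larger p (fun n : nat => n%:R `^ (- (2%:R / (r + 1)%:R)))) :
  with_high_probability p
    (fun n : nat => @every_orientation_has_transitive_clique n r).
Proof.
have r0 : (0 < r)%N by apply: leq_trans hr.
pose M := (2 ^ r)%N.
have M0 : (0 < M)%N by rewrite expn_gt0.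
(* [eps] and [d] match the constants of [supersaturation]. *)
pose eps : R := (4 * M ^ r)%:R^-1.
have eps0 : 0 < eps by rewrite invr_gt0 ltr0n muln_gt0 expn_gt0 M0.
pose d : R := (8 * M ^ 2)%:R^-1.
have d0 : 0 < d by rewrite invr_gt0 ltr0n muln_gt0 expn_gt0 M0.
have d1 : d <= 1 by rewrite invf_le1 ?ltr0n ?ler1n ?muln_gt0 ?expn_gt0 ?M0.
have [B [q0 [B0 q00 cont]]] := transitive_containers r0 eps0.
(* [L] makes the term [expR (- L)] of [prob_failure_le] at most [d / 4]; then [kappa], through
   [q <= kappa * p n], makes its term [L * b] at most [d / 4 * (p n * n ^ 2)]. *)
pose L : R := Num.max 0 (- ln (d / 4)).
have L0 : 0 <= L by rewrite le_max lexx.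
have Ld : expR (- L) <= d / 4.
  rewrite -[leRHS](@lnK _ (d / 4)) ?posrE ?divr_gt0 // ler_expR lerNl.
  by rewrite le_max lexx orbT.
pose kappa : R := Num.min (Num.min q0 1) (d / (4 * (B * L + 1))).
have BL0 : 0 < 4 * (B * L + 1) by rewrite mulr_gt0 // ltr_wpDl // mulr_ge0 // ltW.
have kappa0 : 0 < kappa by rewrite !lt_min q00 ltr01 divr_gt0.
have kq0 : kappa <= q0 by rewrite /kappa !ge_min lexx.
have k1 : kappa <= 1 by rewrite /kappa !ge_min lexx orbT.
have kd : B * L * kappa <= d / 4.
  apply: (@le_trans _ _ ((B * L + 1) * kappa)); first by rewrite ler_wpM2r ?lerDl // ltW.
  rewrite mulrC -ler_pdivlMr ?ltr_wpDl ?mulr_ge0 ?(ltW B0) //.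
  by rewrite -mulrA -invfM ge_min lexx orbT.
have bound : (\forall n \near \oo,
    gnp_prob (p n) (predC (@every_orientation_has_transitive_clique n r))
      <= (d / 2)^-1 * harmonic n)%classic.
  case: hp => pn0 /cvgrPdist_lt /(_ _ kappa0) qp.
  near=> n.
  have n0 : (0 < n)%N by near: n; exact: nbhs_infty_gt.
  have Mn : (4 * M ^ 2 <= n)%N by near: n; exact: nbhs_infty_ge.
  have N0 : 0 < n%:R :> R by rewrite ltr0n.
  have [p0 p1] := andP (p01 n).
  have ppos : 0 < p n by rewrite lt_neqAle eq_sym p0 andbT; near: n.
  have [] := threshold_power R n0 r0.
  have : `|0 - n%:R `^ (- (2%:R / (r + 1)%:R)) / p n| < kappa by near: n.
  set q := _ `^ _ => qk qpos q1 qn qN.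
  have qkp : q <= kappa * p n.
    move: qk; rewrite sub0r normrN ger0_norm ?divr_ge0 ?(ltW qpos) // => /ltW.
    by rewrite ler_pdivrMr.
  have qq0 : q <= q0.
    apply: le_trans qkp _; apply: (@le_trans _ _ kappa); last exact: kq0.
    by rewrite ler_piMr // ltW.
  (* This uses [n <= q * n ^ 2] and [q <= p n], the latter from [kappa <= 1]. *)
  have pN : n%:R <= p n * n%:R ^+ 2.
    apply: le_trans qN _; rewrite ler_wpM2r ?exprn_ge0 //.
    by apply: le_trans qkp _; rewrite ler_piMl.
  have C := cont n q n0 qpos qq0 q1 qn (le_trans _ qN).
  have miss (D : {set 'I_n * 'I_n}) : #|tcopies r D|%:R < eps * n%:R ^+ r ->
      d * n%:R ^+ 2 <= #|missing D|%:R.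
    move=> few; rewrite mulrC ler_pdivrMr ?ltr0n ?muln_gt0 ?expn_gt0 ?M0 //.
    rewrite -natrX -natrM ler_nat mulnC; apply: (@supersaturation n r M) => //.
    rewrite -(ler_nat R) natrM natrX; apply: ltW; rewrite -ltr_pdivlMl //.
    by rewrite ltr0n muln_gt0 expn_gt0 M0.
  apply: le_trans (prob_failure_le (p01 n) L0 (C _) miss) _; first by rewrite ler1n.
  (* Of the exponent [- d], the two terms of size [d / 4] leave [- d / 2]. *)
  apply: (@le_trans _ _ (expR (- (d / 2 * n%:R)))).
    rewrite ler_expR; set P := p n * n%:R ^+ 2 in pN *.
    have P0 : 0 <= P by apply: le_trans pN.
    have h1 : L * (B * (q * n%:R ^+ 2)) <= d / 4 * P.
      apply: (@le_trans _ _ (B * L * kappa * P)); last exact: ler_wpM2r.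
      rewrite mulrA [L * B]mulrC -[leRHS]mulrA; apply: ler_wpM2l.
        by rewrite mulr_ge0 // ltW.
      by rewrite /P mulrA; apply: ler_wpM2r; rewrite ?exprn_ge0.
    have h2 : expR (- L) * P <= d / 4 * P by exact: ler_wpM2r.
    have h3 : d / 2 * n%:R <= d / 2 * P by apply: ler_wpM2l; rewrite // divr_ge0 // ltW.
    by rewrite mulrBl; move: h1 h2 h3; clear; lra.
  (* As [d / 2 <= 1], one has [d / 2 * n.+1 <= 1 + d / 2 * n <= expR (d / 2 * n)]. *)
  rewrite expRN /harmonic /= -[leRHS]invfM lef_pV2 ?posrE ?expR_gt0 ?mulr_gt0 ?divr_gt0 //.
  apply: le_trans (expR_ge1Dx _); rewrite -[n.+1%:R]natr1 mulrDr mulr1 addrC lerD2r.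
  by rewrite ler_pdivrMr // mul1r; apply: le_trans d1 _; rewrite ler1n.
apply: (@squeeze_cvgr _ _ _ R (fun n => 1 - (d / 2)^-1 * harmonic n) (fun=> 1)); last 2 first.
- rewrite -[X in (_ --> X)%classic]subr0; apply: cvgB; first exact: cvg_cst.
  rewrite -(mulr0 (d / 2)^-1); apply: cvgM; first exact: cvg_cst.
  exact: cvg_harmonic.
- exact: cvg_cst.
near=> n.
rewrite gnp_prob_predC lerB //=; last by near: n.
rewrite gerBl; apply: sumr_ge0 => G _; exact: gnp_weight_ge0.
Unshelve. all: by end_near.
Qed.
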